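(* A puzzle $p\colon G(J)\to D'(K)$ is realizable if and only if all of its subcubes are realizable.
   Context: Let $R\in\{\mathbb Z,\mathbb Z_2\}$; an $R$-basis of $R^n$ is a $\mathbb Z$-basis of $\mathbb Z^n$ ($R=\mathbb Z$) or a basis of $\mathbb Z_2^n$ ($R=\mathbb Z_2$). $K$ is an $(n-1)$-dimensional star-shaped simplicial sphere on $[m]$. An $R$-characteristic map over a complex with $(N-1)$-dimensional facets is a map from its vertices to $R^N$ sending each $(N-1)$-face to an $R$-basis; D-J equivalence is equality up to left multiplication by $GL_N(R)$. For a face $\sigma$, $\operatorname{proj}_\sigma\lambda$ is the characteristic map on $\operatorname{link}\sigma$ given by $w\mapsto[\lambda(w)]\in R^N/\langle\lambda(u):u\in\sigma\rangle$. For $J=(j_1,\dots,j_m)\in\mathbb Z_{>0}^m$, $K(J)$ is the complex on vertices $\{i_k:1\le i\le m,1\le k\le j_i\}$ whose minimal non-faces are $\bigcup_{i\in\tau}\{i_1,\dots,i_{j_i}\}$ for $\tau$ a minimal non-face of $K$; $\operatorname{wed}_vK=K(J)$ with $j_v=2$, other $j_i=1$. $I(J)=\{\boldsymbol\alpha:1\le\alpha_i\le j_i\}$; $\sigma(\boldsymbol\alpha)$ is the set of all vertices of $K(J)$ except $1_{\alpha_1},\dots,m_{\alpha_m}$, a face whose link is identified with $K$ via $i_{\alpha_i}\mapsto i$. The pre-diagram $D'(K)$: vertices are D-J classes of $R$-characteristic maps over $K$; an edge colored $v$ joins $\lambda_1,\lambda_2$ iff some $R$-characteristic map $\Lambda$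 over $\operatorname{wed}_vK$ has $\operatorname{proj}_{v_1}\Lambda=\lambda_1$, $\operatorname{proj}_{v_2}\Lambda=\lambda_2$ (links of $v_1,v_2$ identified with $K$ by sending the other of $v_1,v_2$ to $v$). $G(J)$ is the $1$-skeleton of $\prod_i\Delta^{j_i-1}$ with vertex set $I(J)$, edges joining vertices differing in exactly one coordinate $v$, colored $v$. A puzzle of $(K,J)$ is a color-preserving graph homomorphism $G(J)\to D'(K)$; it is realizable if it equals $\boldsymbol\alpha\mapsto\operatorname{proj}_{\sigma(\boldsymbol\alpha)}\Lambda$ for some $R$-characteristic map $\Lambda$ over $K(J)$. For nonempty $S_i\subseteq[j_i]$, the restriction of a puzzle to the induced subgraph on $\prod_i S_i$, identified with $G(J')$, $j'_i=|S_i|$, via order-preserving bijections, is a subpuzzle (a puzzle of $(K,J')$); it is a subcube if all $|S_i|\le 2$. *)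

(* Defs.v *)
From HB Require Import structures.
From mathcomp Require Import all_boot all_order all_algebra.
From Stdlib Require Rdefinitions.

Set Implicit Arguments.
Unset Strict Implicit.
Unset Printing Implicit Defensive.

Import GRing.Theory.
Local Open Scope ring_scope.

Definition simplicial_complex (V : finType) (K : {set {set V}}) : Prop :=
  set0 \in K /\
  (forall s t : {set V}, s \in K -> t \subset s -> t \in K).

Definition no_ghost_vertex (V : finType) (K : {set {set V}}) : Prop :=
  forall x : V, [set x] \in K.

Definition has_dim_pred (V : finType) (K : {set {set V}}) (n : nat) : Prop :=
  (forall s, s \in K -> #|s| <= n)%N /\ (exists2 s, s \in K & #|s| = n).

(* Star-shaped simplicial spheres, via real geometry (Stdlib reals).
   K (on [m]) is an (n-1)-dimensional star-shaped sphere iff there are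
   vectors v_1..v_m in R^n (the rays from the star point through the
   vertices of a geometric realization) such that every x in R^n has a
   unique expression x = sum_{i in s} c_i v_i with s a face of K and
   c_i > 0 for i in s (c_i = 0 outside s), i.e. K is the underlying
   complex of a complete simplicial fan. *)

Definition Rsum (I : finType) (A : {set I}) (F : I -> Rdefinitions.R)
  : Rdefinitions.R :=
  \big[Rdefinitions.Rplus/Rdefinitions.IZR BinNums.Z0]_(i in A) F i.

Definition fan_rep (m n : nat) (K : {set {set 'I_m}})
  (v : 'I_m -> 'I_n -> Rdefinitions.R) (x : 'I_n -> Rdefinitions.R)
  (c : 'I_m -> Rdefinitions.R) : Prop :=
  exists2 s, s \in K &
    [/\ (forall i, i \in s -> Rdefinitions.Rlt (Rdefinitions.IZR BinNums.Z0) (c i)),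
        (forall i, i \notin s -> c i = Rdefinitions.IZR BinNums.Z0) &
        (forall k, x k = Rsum s (fun i => Rdefinitions.Rmult (c i) (v i k)))].

Definition star_shaped_sphere (m n : nat) (K : {set {set 'I_m}}) : Prop :=
  [/\ simplicial_complex K, no_ghost_vertex K, has_dim_pred K n &
      exists v : 'I_m -> 'I_n -> Rdefinitions.R,
        forall x : 'I_n -> Rdefinitions.R,
          (exists c, fan_rep K v x c) /\
          (forall c1 c2, fan_rep K v x c1 -> fan_rep K v x c2 ->
                         forall i, c1 i = c2 i)].

Definition coef_ring (b : bool) : comUnitRingType :=
  if b then (int : comUnitRingType) else ('F_2 : comUnitRingType).

Section CharMaps.
Variable R : comUnitRingType.

Definition in_span (V : finType) (N : nat) (S : {set V})
  (f : V -> 'rV[R]_N) (x : 'rV[R]_N) : Prop :=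
  exists c : V -> R, x = \sum_(u in S) c u *: f u.

Definition lin_indep (V : finType) (N : nat) (S : {set V})
  (f : V -> 'rV[R]_N) : Prop :=
  forall c : V -> R, \sum_(u in S) c u *: f u = 0 ->
    forall u, u \in S -> c u = 0.

Definition is_basis (V : finType) (N : nat) (S : {set V})
  (f : V -> 'rV[R]_N) : Prop :=
  (forall x, in_span S f x) /\ lin_indep S f.

Definition char_map (V : finType) (N : nat) (L : {set {set V}})
  (f : V -> 'rV[R]_N) : Prop :=
  forall s, s \in L -> #|s| = N -> is_basis s f.

(* D-J equivalence (GL_N(R) acting on row vectors from the right,
   i.e. on column vectors from the left). *)
Definition DJ_equiv (V : finType) (N : nat) (f g : V -> 'rV[R]_N) : Prop :=
  exists2 A : 'M[R]_N, A \in unitmx & forall x, g x = f x *m A.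

(* lam lies in the D-J class of proj_s Lam, where the link vertices are
   identified with W via f : W -> V: lam = (pi o Lam o f) for some
   isomorphism R^N / <Lam(u) : u in s>  ~=  R^n, i.e. for some surjective
   P : R^N -> R^n with kernel exactly <Lam(u) : u in s>. *)
Definition proj_class (V W : finType) (N n : nat) (Lam : V -> 'rV[R]_N)
  (s : {set V}) (f : W -> V) (lam : W -> 'rV[R]_n) : Prop :=
  exists P : 'M[R]_(N, n),
    [/\ (forall x, x *m P = 0 <-> in_span s Lam x),
        (forall y : 'rV[R]_n, exists x : 'rV[R]_N, x *m P = y) &
        (forall w, lam w = Lam (f w) *m P)].

End CharMaps.

Definition min_nonface (V : finType) (K : {set {set V}}) (t : {set V}) : bool :=
  (t \notin K) && [forall i in t, (t :\ i) \in K].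

(* vertex i_k of K(J) is Tagged (i) (k) with k : 'I_(J i) (0-based) *)
Definition KJ (m : nat) (K : {set {set 'I_m}}) (J : 'I_m -> nat)
  : {set {set {i : 'I_m & 'I_(J i)}}} :=
  [set S : {set {i : 'I_m & 'I_(J i)}} | [forall t : {set 'I_m}, min_nonface K t ==>
             ~~ ([set x : {i : 'I_m & 'I_(J i)} | tag x \in t] \subset S)]].

Definition dimJ (m n : nat) (J : 'I_m -> nat) : nat :=
  (n + \sum_(i < m) (J i).-1)%N.

Definition Ivert (m : nat) (J : 'I_m -> nat) : Type := forall i : 'I_m, 'I_(J i).

Definition sigma_of (m : nat) (J : 'I_m -> nat) (a : Ivert J)
  : {set {i : 'I_m & 'I_(J i)}} :=
  [set x | tagged x != a (tag x)].

(* identification of link sigma(alpha) with K : i |-> i_{alpha_i} *)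
Definition pick_of (m : nat) (J : 'I_m -> nat) (a : Ivert J)
  : 'I_m -> {i : 'I_m & 'I_(J i)} :=
  fun i => Tagged (fun j => 'I_(J j)) (a i).

Definition proj_alpha (R : comUnitRingType) (m n : nat) (J : 'I_m -> nat)
  (Lam : {i : 'I_m & 'I_(J i)} -> 'rV[R]_(dimJ n J)) (a : Ivert J)
  (lam : 'I_m -> 'rV[R]_n) : Prop :=
  proj_class Lam (sigma_of a) (pick_of a) lam.

(* wed_v K = K(J) with j_v = 2 and j_i = 1 otherwise *)
Definition Jw (m : nat) (v : 'I_m) : 'I_m -> nat := fun i => (i == v).+1.

(* alpha picking v_2 (so sigma = {v_1}), resp. v_1 (so sigma = {v_2}) *)
Definition wsel2 (m : nat) (v : 'I_m) : Ivert (Jw v) := fun i => inord (i == v).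
Definition wsel1 (m : nat) (v : 'I_m) : Ivert (Jw v) := fun i => ord0.

Definition DJ_edge (R : comUnitRingType) (m n : nat) (K : {set {set 'I_m}})
  (v : 'I_m) (lam1 lam2 : 'I_m -> 'rV[R]_n) : Prop :=
  exists Lam : {i : 'I_m & 'I_(Jw v i)} -> 'rV[R]_(dimJ n (Jw v)),
    [/\ char_map (KJ K (Jw v)) Lam,
        proj_alpha Lam (wsel2 v) lam1 &
        proj_alpha Lam (wsel1 v) lam2].

(* Puzzles: maps I(J) -> (representatives of) D-J classes of char maps
   over K, sending colored edges of G(J) to edges of D'(K) of the same
   color. *)

Definition is_puzzle (R : comUnitRingType) (m n : nat) (K : {set {set 'I_m}})
  (J : 'I_m -> nat) (p : Ivert J -> 'I_m -> 'rV[R]_n) : Prop :=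
  (forall a, char_map K (p a)) /\
  (forall (a b : Ivert J) (v : 'I_m),
     (forall i, i != v -> a i = b i) -> (a v < b v)%N ->
     DJ_edge K v (p a) (p b)).

Definition realizable (R : comUnitRingType) (m n : nat) (K : {set {set 'I_m}})
  (J : 'I_m -> nat) (p : Ivert J -> 'I_m -> 'rV[R]_n) : Prop :=
  exists Lam : {i : 'I_m & 'I_(J i)} -> 'rV[R]_(dimJ n J),
    char_map (KJ K J) Lam /\ (forall a, proj_alpha Lam a (p a)).

(* restriction of p to prod_i S_i, where e i : 'I_(J' i) -> 'I_(J i) is the
   order-preserving bijection onto S_i *)
Definition subpuzzle (R : comUnitRingType) (m n : nat) (J J' : 'I_m -> nat)
  (e : forall i, 'I_(J' i) -> 'I_(J i)) (p : Ivert J -> 'I_m -> 'rV[R]_n)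
  : Ivert J' -> 'I_m -> 'rV[R]_n :=
  fun b => p (fun i => e i (b i)).

Definition strictly_increasing (k l : nat) (f : 'I_k -> 'I_l) : Prop :=
  forall x y : 'I_k, (x < y)%N -> (f x < f y)%N.

(* Main.v *)
Require Import Defs.
From HB Require Import structures.
From mathcomp Require Import all_boot all_order all_algebra.
From mathcomp Require Import ring lra.
From Stdlib Require Import FunctionalExtensionality Classical Epsilon.
From mathcomp Require Import Rstruct.

Set Implicit Arguments.
Unset Strict Implicit.
Unset Printing Implicit Defensive.

Import Order.TTheory GRing.Theory Num.Theory.
Local Open Scope ring_scope.

(** View a characteristic map [Lam] over [K(J)] through its row space L, a
    submodule of the functions on the vertices of [K(J)]; a D-J class is the same
    thing as a row space. Projecting to sigma(a) amounts to intersecting L with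
    the functions supported on the vertices picked by [a], so a puzzle [p] is
    realized by L iff the row space of each [p a], extended by zero, is that
    intersection.

    Fix a base vertex [a0]. Since K is pure, each [p a v] is unimodular, so L has
    an element supported on [move1 a0 a v] with value 1 at the vertex v_(a v);
    subtracting multiples of these shows that the row space of [p a] lies in the
    sum of the row spaces of [p a0] and of the [p (move1 a0 a v)], for [v] in
    [moved a0 a]. Conversely, if this holds for every [a], the sum of the row
    spaces at [a0] and its neighbours has rank dim K(J) + 1 (by the edge
    condition, each neighbour contributes one new function) and realizes [p].
    The condition at [a] only involves vertices of the subcube spanned by [a0]
    and [a]. *)

(** * Purity of complete simplicial fans *)

Lemma infinite_pigeonhole (T : finType) (f : nat -> T) :
  exists t, forall N : nat, exists2 k, (N <= k)%N & f k = t.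
Proof.
apply: NNPP => noT.
have /fin_all_exists[N NP] t : exists N, forall k, (N <= k)%N -> f k <> t.
  apply: NNPP => noN; apply: noT; exists t => N; apply: NNPP => nok.
  by apply: noN; exists N => k Nk fk; apply: nok; exists k.
pose k := (\max_t N t)%N.
by apply: (NP (f k) k) => //; apply: leq_bigmax.
Qed.

Section Fan.
Variables (F : archiRealFieldType) (m n : nat) (K : {set {set 'I_m}}).
Variable v : 'I_m -> 'rV[F]_n.

Definition cone_rep (x : 'rV[F]_n) (c : 'I_m -> F) (s : {set 'I_m}) :=
  [/\ s \in K, forall i, i \in s -> 0 < c i, forall i, i \notin s -> c i = 0 &
      x = \sum_(i in s) c i *: v i].

(** For [u < 0] the inequality forces k + 1 < [w / u], which the Archimedean property excludes for
    large k. *)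
Lemma inv_frequently_ge0 (u w : F) :
  (forall N : nat, exists2 k, (N <= k)%N & k.+1%:R^-1 * w < u) -> 0 <= u.
Proof.
move=> H; rewrite leNgt; apply/negP => u0.
have [k Nk] := H (Num.bound `|w / u|); rewrite ltNge => /negP; apply.
rewrite ler_pdivlMl ?ltr0Sn // -ler_ndivrMr //.
apply: le_trans (ler_norm _) _; apply: ltW; apply: lt_le_trans (archi_boundP _) _.
  exact: normr_ge0.
by rewrite ler_nat ltnW // ltnS.
Qed.

Hypothesis K_down : forall s t : {set 'I_m}, s \in K -> t \subset s -> t \in K.
Hypothesis K_dim : forall s, s \in K -> (#|s| <= n)%N.
Hypothesis fan_exists : forall x, exists c s, cone_rep x c s.
Hypothesis fan_unique : forall x c1 s1 c2 s2,
  cone_rep x c1 s1 -> cone_rep x c2 s2 -> forall i, c1 i = c2 i.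

(* If a maximal face s had fewer than n vertices, move from a point x in the
   open cone of s in a direction y outside the span of s. The points x + y/k lie
   in the open cone of one face t for infinitely many k, so x is in the closed
   cone of t; hence s \subset t, so s = t and y is in the span. *)
Lemma complete_fan_pure s0 : s0 \in K ->
  exists s : {set 'I_m}, [/\ s \in K, s0 \subset s & #|s| = n].
Proof.
move=> s0K.
have [s smax s0s] := @maxset_exists _ (fun s => s \in K) _ s0K.
have /maxsetP[sK max] := smax.
exists s; split=> //; apply/eqP; rewrite eqn_leq K_dim //= leqNgt; apply/negP => sn.
pose M := \matrix_(i < #|s|) v (enum_val i).
have [y yM] : exists y : 'rV[F]_n, ~~ (y <= M)%MS.
  have /row_subPn[i iM] : ~~ (1%:M <= M)%MS; last by exists (row i 1%:M).
  apply/negP => /mxrankS; rewrite mxrank1 => /leq_trans/(_ (rank_leq_row _)).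
  by rewrite leqNgt sn.
pose x := \sum_(i in s) v i.
pose eps (k : nat) : F := k.+1%:R^-1.
have eps_gt0 k : 0 < eps k by rewrite invr_gt0 ltr0Sn.
have eps_lt k l : (k < l)%N -> eps l < eps k.
  by move=> kl; rewrite ltf_pV2 ?posrE ?ltr0Sn // ltr_nat.
have wit k := constructive_indefinite_description _ (fan_exists (x + eps k *: y)).
pose c k := proj1_sig (wit k).
have face k := constructive_indefinite_description _ (proj2_sig (wit k)).
pose f k := proj1_sig (face k).
have fP k : cone_rep (x + eps k *: y) (c k) (f k) := proj2_sig (face k).
have [t tP] := infinite_pigeonhole f.
have [k1 _ f1] := tP 0%N; have [k2 k12 f2] := tP k1.+1.
have := fP k1; have := fP k2; rewrite f1 f2.
set a := c k1; set b := c k2; set e1 := eps k1; set e2 := eps k2.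
move=> [_ b0 bN bE] [tK a0 aN aE].
have e12 : 0 < e1 - e2 by rewrite subr_gt0 eps_lt.
have e12N : e1 - e2 != 0 by rewrite gt_eqF.
have lim i : i \in t -> 0 <= e1 * b i - e2 * a i.
  move=> it; apply: (@inv_frequently_ge0 _ (b i - a i)) => N.
  have [k] := tP (maxn N k2.+1); rewrite geq_max => /andP[Nk k2k] fk.
  exists k => //; have := fP k; rewrite fk -/(eps k); set e := eps k.
  move=> [_ d0 dN dE].
  have e2e : 0 < e2 - e by rewrite subr_gt0 eps_lt.
  have e1e : 0 < e1 - e by lra.
  have e1eN : e1 - e != 0 by rewrite gt_eqF.
  (* As e < e2 < e1, [x + e2 *: y] is a convex combination of the points at e1 and e; uniqueness
     then gives [b = g]. *)
  pose g i := ((e2 - e) / (e1 - e)) * a i + ((e1 - e2) / (e1 - e)) * c k i.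
  have grep : cone_rep (x + e2 *: y) g t.
    split=> // [j jt|j jt|].
    - by rewrite addr_gt0 // mulr_gt0 ?divr_gt0 ?a0 ?d0.
    - by rewrite /g aN // dN // !mulr0 addr0.
    under eq_bigr do rewrite scalerDl -!scalerA.
    rewrite big_split /= -!scaler_sumr -aE -dE.
    apply/rowP => j; rewrite !mxE; field; exact: e1eN.
  have bg := fan_unique (And4 tK b0 bN bE) grep i.
  have -> : e1 * b i - e2 * a i = e * (b i - a i) + (e1 - e2) * c k i.
    rewrite bg /g; field; exact: e1eN.
  by rewrite ltrDl mulr_gt0 // d0.
(* The coefficients at e1 and e2, extrapolated affinely to parameter 0, that is to [x]. *)
pose h i := (e1 * b i - e2 * a i) / (e1 - e2).
have hN i : i \notin t -> h i = 0.
  by move=> it; rewrite /h bN // aN // !mulr0 subr0 mul0r.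
have h0 i : i \in t -> 0 <= h i by move=> it; rewrite divr_ge0 ?lim // ltW.
have hrep : cone_rep x h [set i in t | 0 < h i].
  split=> [|i|i|].
  - by apply: K_down tK _; apply/subsetP => i; rewrite inE => /andP[].
  - by rewrite inE => /andP[].
  - rewrite inE negb_and -implybE => /implyP hi.
    have [/[dup] it /h0|/hN//] := boolP (i \in t).
    by rewrite le_eqVlt (negPf (hi it)) orbF => /eqP.
  transitivity (\sum_(i in t) h i *: v i); last first.
    rewrite (big_setID [set i | 0 < h i]) /= [X in _ + X]big1 ?addr0.
      by apply: eq_bigl => i; rewrite !inE.
    move=> i; rewrite !inE => /andP[hi /h0]; rewrite le_eqVlt (negPf hi) orbF.
    by move=> /eqP <-; rewrite scale0r.
  under eq_bigr do rewrite /h [_ / _]mulrC -scalerA scalerBl -!scalerA.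
  rewrite -scaler_sumr sumrB -!scaler_sumr -aE -bE.
  apply/rowP => j; rewrite !mxE; field; exact: e12N.
have xrep : cone_rep x (fun i => (i \in s)%:R) s.
  split=> // [i ->|i /negPf->|] //.
  by apply: eq_bigr => i ->; rewrite scale1r.
have hs := fan_unique hrep xrep.
have st : s \subset t.
  apply/subsetP => i si; apply/negPn/negP => /hN/eqP.
  by rewrite hs si oner_eq0.
have ts := max t tK st.
case/negP: yM.
have -> : y = (e1 - e2)^-1 *: (\sum_(i in t) (a i - b i) *: v i).
  under eq_bigr do rewrite scalerBl.
  rewrite sumrB -aE -bE; apply/rowP => j; rewrite !mxE; field; exact: e12N.
apply: scalemx_sub; rewrite ts; apply: summx_sub => i si; apply: scalemx_sub.
by rewrite -(enum_rankK_in si si) -(rowK (fun i => v (enum_val i))) row_sub.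
Qed.

End Fan.

Lemma star_shaped_sphere_pure m n (K : {set {set 'I_m}}) :
  star_shaped_sphere n K ->
  forall i, exists s : {set 'I_m}, [/\ s \in K, i \in s & #|s| = n].
Proof.
move=> [[_ Kd] Kv [Kn _] [v vP]] i.
pose w i : 'rV[Rdefinitions.R]_n := \row_k v i k.
have repE x c s : cone_rep K w x c s -> fan_rep K v (fun k => x 0 k) c.
  move=> [sK c0 cN xE]; exists s => //; split=> // [j /c0/RltP//|k].
  by rewrite {1}xE summxE; apply: eq_bigr => j _; rewrite !mxE.
have [x|x c1 s1 c2 s2 /repE r1 /repE r2|s [sK si sn]] :=
    @complete_fan_pure Rdefinitions.R _ _ K w Kd Kn _ _ [set i] (Kv i).
- have [[c [s sK [c0 cN xE]]] _] := vP (fun k => x 0 k).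
  exists c, s; split=> // [j /c0/RltP//|].
  by apply/rowP => k; rewrite xE summxE; apply: eq_bigr => j _; rewrite !mxE.
- have [_] := vP (fun k => x 0 k); exact.
by exists s; rewrite -sub1set.
Qed.

(** * Bases, dual functionals and factorization *)

Lemma mulmx1C_eq (R : comNzRingType) (k l : nat) (A : 'M[R]_(k, l)) B :
  k = l -> A *m B = 1%:M -> B *m A = 1%:M.
Proof. by move=> kl; case: _ / kl A B => A B; apply: mulmx1C. Qed.

Section DualBasis.
Variables (R : comUnitRingType) (V : finType) (N : nat).
Implicit Types (S : {set V}) (f : V -> 'rV[R]_N).

(** Coordinate functionals, as columns. For [#|S| = N], having them is equivalent to being a
    basis. *)
Definition dual_family S f (Y : V -> 'cV[R]_N) : Prop :=
  forall x u, x \in S -> u \in S -> f x *m Y u = (x == u)%:R%:M.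

Lemma dual_family_expand S f Y : #|S| = N -> dual_family S f Y ->
  forall x, x = \sum_(u in S) (x *m Y u) 0 0 *: f u.
Proof.
move=> cS dY x.
pose M := \matrix_(i < #|S|) f (enum_val i).
pose D := \matrix_(i < N, j < #|S|) Y (enum_val j) i 0.
have DM : D *m M = 1%:M.
  apply: mulmx1C_eq => //; apply/matrixP => i j.
  have /matrixP/(_ 0 0) := dY _ _ (enum_valP i) (enum_valP j).
  rewrite !mxE (inj_eq enum_val_inj) eqxx mulr1n => <-.
  by apply: eq_bigr => k _; rewrite !mxE.
rewrite -[x in LHS]mulmx1 -DM mulmxA mulmx_sum_row [RHS]big_enum_val.
apply: eq_bigr => i _; rewrite rowK; congr (_ *: _).
by rewrite !mxE; apply: eq_bigr => k _; rewrite !mxE.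
Qed.

Lemma dual_family_basis S f Y : #|S| = N -> dual_family S f Y -> is_basis S f.
Proof.
move=> cS dY; split=> [x|c c0 u uS].
  by exists (fun u => (x *m Y u) 0 0); apply: dual_family_expand.
have := congr1 (mulmx^~ (Y u)) c0; rewrite mul0mx mulmx_suml (bigD1 u) //=.
rewrite big1 => [|x /andP[xS xu]]; last first.
  by rewrite -scalemxAl dY // (negPf xu) scale_scalar_mx mulr0 raddf0.
rewrite -scalemxAl dY // eqxx addr0 => /matrixP/(_ 0 0).
by rewrite !mxE mulr1.
Qed.

(** Spanning gives a left inverse of the matrix of the family; this matrix is square, so the columns
    of the inverse are dual functionals. *)
Lemma basis_dual_family S f : #|S| = N -> is_basis S f ->
  exists Y, dual_family S f Y.
Proof.
move=> cS [sp _].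
pose M := \matrix_(i < #|S|) f (enum_val i).
have [C CM] : exists C : 'M[R]_(N, #|S|), C *m M = 1%:M.
  suff /fin_all_exists[c cP] i : exists c : 'rV[R]_#|S|, c *m M = row i 1%:M.
    by exists (\matrix_i c i); apply/row_matrixP => i; rewrite row_mul rowK cP.
  have [c ->] := sp (row i 1%:M); exists (\row_j c (enum_val j)).
  rewrite mulmx_sum_row [RHS]big_enum_val; apply: eq_bigr => j _.
  by rewrite rowK mxE.
have /matrixP MC := mulmx1C_eq (esym cS) CM.
case: (set_0Vmem S) => [->|[u0 u0S]].
  by exists (fun=> 0) => x u; rewrite inE.
exists (fun u => col (enum_rank_in u0S u) C) => x u xS uS.
have := MC (enum_rank_in u0S x) (enum_rank_in u0S u).
rewrite !mxE => E; apply/matrixP => i j.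
rewrite !ord1 !mxE eqxx mulr1n.
rewrite (_ : (x == u) = (enum_rank_in u0S x == enum_rank_in u0S u)); last first.
  by rewrite -(inj_eq enum_val_inj) !enum_rankK_in.
rewrite -E; apply: eq_bigr => k _.
by rewrite !mxE enum_rankK_in.
Qed.

End DualBasis.

(** With a section [Q] of [P], each [x - x P Q] lies in the kernel of [P], hence in the span, where
    [Y] vanishes; so [Y = P Q Y]. *)
Lemma mulmx_factor (R : comUnitRingType) (V : finType) (N n k : nat)
    (Lam : V -> 'rV[R]_N) s (P : 'M_(N, n)) (Y : 'M[R]_(N, k)) :
    (forall x, x *m P = 0 -> in_span s Lam x) ->
    (forall y : 'rV[R]_n, exists x : 'rV[R]_N, x *m P = y) ->
    (forall u, u \in s -> Lam u *m Y = 0) ->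
  exists A : 'M_(n, k), Y = P *m A.
Proof.
move=> kerP surjP Y0.
have [Q QP] : exists Q : 'M[R]_(n, N), Q *m P = 1%:M.
  suff /fin_all_exists[q qP] i : exists q : 'rV[R]_N, q *m P = row i 1%:M.
    by exists (\matrix_i q i); apply/row_matrixP => i; rewrite row_mul rowK qP.
  exact: surjP.
exists (Q *m Y); apply/eqP; rewrite -subr_eq0 mulmxA; apply/eqP/row_matrixP => i.
rewrite row0 rowE.
have [|c cE] := kerP (delta_mx 0 i *m (1%:M - P *m Q)).
  by rewrite -mulmxA mulmxBl mul1mx -mulmxA QP mulmx1 subrr mulmx0.
rewrite -{1}[Y]mul1mx -mulmxBl mulmxA cE mulmx_suml big1 // => u us.
by rewrite -scalemxAl Y0 // scaler0.
Qed.

(** * Row spaces, projections and edges of D'(K) *)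

Section Puzzles.
Variables (R : comUnitRingType) (m n : nat).
Implicit Types (J : 'I_m -> nat) (K : {set {set 'I_m}}).

Definition spread J (a : Ivert J) k (lam : 'I_m -> 'rV[R]_k)
    (x : {i : 'I_m & 'I_(J i)}) : 'rV[R]_k :=
  if tagged x == a (tag x) then lam (tag x) else 0.

(** Containment of row spaces: every coordinate of [G] is a fixed linear functional of [Lam]. *)
Definition row_span (V : Type) N (Lam : V -> 'rV[R]_N) k (G : V -> 'rV[R]_k) :=
  exists P : 'M_(N, k), forall x, G x = Lam x *m P.

Section Spread.
Variables (J : 'I_m -> nat) (a : Ivert J) (k : nat).

Lemma spread_mul l (lam : 'I_m -> 'rV[R]_k) (B : 'M_(k, l)) x :
  spread a (fun i => lam i *m B) x = spread a lam x *m B.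
Proof. by rewrite /spread; case: ifP => // _; rewrite mul0mx. Qed.

Lemma spread_pick (lam : 'I_m -> 'rV[R]_k) i : spread a lam (pick_of a i) = lam i.
Proof. by rewrite /spread /pick_of /= eqxx. Qed.

End Spread.

Section RowSpan.
Variables (V : Type) (N : nat) (Lam : V -> 'rV[R]_N) (k : nat).
Implicit Type G : V -> 'rV[R]_k.

Lemma row_span_ext G1 G2 : (forall x, G1 x = G2 x) ->
  row_span Lam G1 -> row_span Lam G2.
Proof. by move=> E [P PE]; exists P => x; rewrite -E. Qed.

Lemma row_spanD G1 G2 : row_span Lam G1 -> row_span Lam G2 ->
  row_span Lam (fun x => G1 x + G2 x).
Proof. by move=> [P PE] [Q QE]; exists (P + Q) => x; rewrite PE QE mulmxDr. Qed.

Lemma row_span_sum (I : finType) (D : {pred I}) (G : I -> V -> 'rV[R]_k) :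
  (forall i, i \in D -> row_span Lam (G i)) ->
  row_span Lam (fun x => \sum_(i in D) G i x).
Proof.
move=> GS.
have /fin_all_exists[P PE] i : exists P : 'M_(N, k), i \in D ->
    forall x, G i x = Lam x *m P.
  have [iD|] := boolP (i \in D); last by exists 0.
  by have [P PE] := GS i iD; exists P.
exists (\sum_(i in D) P i) => x; rewrite mulmx_sumr.
by apply: eq_bigr => i iD; apply: PE.
Qed.

Lemma row_span_mul l (G : V -> 'rV[R]_l) (B : 'M_(l, k)) :
  row_span Lam G -> row_span Lam (fun x => G x *m B).
Proof. by move=> [P PE]; exists (P *m B) => x; rewrite PE mulmxA. Qed.

End RowSpan.

Section ProjAlpha.
Variables (J : 'I_m -> nat) (Lam : {i : 'I_m & 'I_(J i)} -> 'rV[R]_(dimJ n J)).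
Variables (a : Ivert J) (lam : 'I_m -> 'rV[R]_n).
Hypothesis prj : proj_alpha Lam a lam.

Lemma proj_alpha_row_span : row_span Lam (spread a lam).
Proof.
case: prj => P [kerP _ lamE]; exists P => -[i j]; rewrite /spread /=.
case: eqVneq => [->|ja]; first exact: lamE.
apply/esym/kerP; exists (fun u => (u == Tagged (fun j => 'I_(J j)) j)%:R).
rewrite (bigD1 (Tagged (fun j => 'I_(J j)) j)) ?inE //= eqxx scale1r.
by rewrite big1 ?addr0 // => u /andP[_ /negPf->]; rewrite scale0r.
Qed.

(** Functions in the row space of [Lam] supported on the vertices picked by [a] come from the row
    space of [lam]. *)
Lemma proj_alpha_factor k (Y : 'M[R]_(_, k)) :
    (forall u, u \in sigma_of a -> Lam u *m Y = 0) ->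
  exists A : 'M_(n, k), forall i, Lam (pick_of a i) *m Y = lam i *m A.
Proof.
case: prj => P [kerP surjP lamE] Y0.
have [|A ->] := mulmx_factor (P := P) _ surjP Y0; first by move=> x /kerP.
by exists A => i; rewrite lamE mulmxA.
Qed.

End ProjAlpha.

(* The row spaces of [lam1] and [lam2] have the same functions vanishing at [v]. *)
Lemma proj_alpha_link J (Lam : {i : 'I_m & 'I_(J i)} -> 'rV[R]_(dimJ n J))
    (a b : Ivert J) (v : 'I_m) lam1 lam2 k (Y : 'M[R]_(n, k)) :
  (forall i, i != v -> a i = b i) ->
  proj_alpha Lam a lam1 -> proj_alpha Lam b lam2 ->
  lam2 v *m Y = 0 ->
  exists A : 'M_(n, k), forall i, lam2 i *m Y = lam1 i *m A.
Proof.
move=> ab pa /proj_alpha_row_span[P PE] Yv.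
have [|A AE] := proj_alpha_factor pa (Y := P *m Y).
  move=> [i j]; rewrite inE /= => ja; rewrite mulmxA -PE /spread /=.
  case: eqVneq => [jb|_]; last by rewrite mul0mx.
  have [->//|/ab E] := eqVneq i v.
  by rewrite E -jb eqxx in ja.
exists A => i; rewrite -AE mulmxA -PE /spread /=.
case: eqVneq => // abi; rewrite mul0mx.
by have [->//|/ab E] := eqVneq i v; rewrite E eqxx in abi.
Qed.

(** What the edge condition says about row spaces: functions from [p b] vanishing at [v] also come
    from [p a]. This passes to subpuzzles. *)
Definition link_compatible J (p : Ivert J -> 'I_m -> 'rV[R]_n) :=
  forall (a b : Ivert J) v, (forall i, i != v -> a i = b i) ->
  forall Y : 'M[R]_n, p b v *m Y = 0 ->
  exists A : 'M_n, forall i, p b i *m Y = p a i *m A.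

Lemma is_puzzle_link K J (p : Ivert J -> 'I_m -> 'rV[R]_n) :
  is_puzzle K p -> link_compatible p.
Proof.
move=> [_ pE] a b v ab Y pY.
have sel i : i != v -> wsel2 v i = wsel1 v i.
  by move=> iv; apply/val_inj; rewrite /= inordK // (negPf iv).
case: (ltngtP (a v) (b v)) => [avb|bva|/val_inj E].
- have [Lam [_ p1 p2]] := pE a b v ab avb.
  exact: (proj_alpha_link sel p1 p2 pY).
- have [|Lam [_ p1 p2]] := pE b a v _ bva; first by move=> i /ab.
  by apply: (proj_alpha_link _ p2 p1 pY) => i /sel.
have -> : a = b.
  apply: functional_extensionality_dep => i.
  by have [->|/ab] := eqVneq i v.
by exists Y.
Qed.

(** * Facets of K(J) *)

Definition facet_of J (a : Ivert J) (t : {set 'I_m})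
  : {set {i : 'I_m & 'I_(J i)}} :=
  [set x | (tagged x != a (tag x)) || (tag x \in t)].

Lemma card_facet_of J (a : Ivert J) t :
  #|facet_of a t| = (#|t| + \sum_(i < m) (J i).-1)%N.
Proof.
rewrite -sum1_card; under eq_bigl do rewrite inE.
transitivity (\sum_(i < m) \sum_(j < J i | (j != a i) || (i \in t)) 1)%N.
  by rewrite sig_big_dep.
rewrite -[X in (X + _)%N]sum1_card [X in (X + _)%N]big_mkcond -big_split /=.
apply: eq_bigr => i _.
have Ji : (0 < J i)%N by apply: leq_ltn_trans (ltn_ord (a i)).
rewrite sum1_card; case: ifP => it.
  rewrite (eq_card (B := predT)) ?card_ord ?add1n ?prednK // => j.
  by rewrite unfold_in orbT.
rewrite (eq_card (B := predC1 (a i))) ?cardC1 ?card_ord // => j.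
by rewrite unfold_in orbF.
Qed.

(** Otherwise this set contains a minimal non-face of [K], all of whose copies lie in [S]. *)
Lemma KJ_core K J S : S \in KJ K J ->
  [set i | [forall j : 'I_(J i), Tagged (fun i => 'I_(J i)) j \in S]] \in K.
Proof.
rewrite inE => /forallP SK; apply/negPn/negP => cK.
have [t tmin /subsetP tsub] := @minset_exists _ (fun t => t \notin K) _ cK.
have /minsetP[tK tm] := tmin.
have tmn : min_nonface K t.
  rewrite /min_nonface tK; apply/forallP => i; apply/implyP => it.
  apply/negPn/negP => tiK; have /setP/(_ i) := tm _ tiK (subD1set _ _).
  by rewrite !inE eqxx it.
apply: (negP (implyP (SK t) tmn)).
apply/subsetP => -[i j]; rewrite inE /= => /tsub.
by rewrite inE => /forallP; apply.
Qed.

(** Let t be the core of [S], and let [a i] be a copy missing from [S] for each i outside t. Then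
    [S] lies in [facet_of a t], and counting forces equality. *)
Lemma KJ_facetP K J S :
  (forall i, (0 < J i)%N) -> (forall s, s \in K -> #|s| <= n)%N ->
  S \in KJ K J -> #|S| = dimJ n J ->
  exists (a : Ivert J) t, [/\ t \in K, #|t| = n & S = facet_of a t].
Proof.
move=> J0 Kn /KJ_core; set t := [set i | _] => tK cS.
have /fin_all_exists[a aP] i :
    exists j : 'I_(J i), i \notin t -> Tagged (fun i => 'I_(J i)) j \notin S.
  have [it|] := boolP (i \in t); first by exists (Ordinal (J0 i)).
  by rewrite inE => /forallPn[j jS]; exists j.
have sub : S \subset facet_of a t.
  apply/subsetP => -[i j] ijS; rewrite inE /= orbC -implyNb.
  apply/implyP => /aP; by apply: contra => /eqP <-.
have := subset_leq_card sub; rewrite cS card_facet_of leq_add2r => nt.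
have tn : #|t| = n by apply/eqP; rewrite eqn_leq nt Kn.
exists a, t; split => //; apply/eqP; rewrite eqEcard sub.
by rewrite card_facet_of tn cS leqnn.
Qed.

(** * Realizability in terms of row spaces *)

Section RowSpanChar.
Variables (K : {set {set 'I_m}}) (J : 'I_m -> nat).
Variable p : Ivert J -> 'I_m -> 'rV[R]_n.
Hypothesis K_pure :
  forall i, exists s : {set 'I_m}, [/\ s \in K, i \in s & #|s| = n].
Hypothesis p_char : forall a, char_map K (p a).

Lemma char_map_unimodular a i : exists z : 'cV[R]_n, p a i *m z = 1%:M.
Proof.
have [s [sK si sn]] := K_pure i.
have [Y dY] := basis_dual_family sn (p_char a sK sn).
by exists (Y i); rewrite dY // eqxx.
Qed.

Variable Lam : {i : 'I_m & 'I_(J i)} -> 'rV[R]_(dimJ n J).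

(** The duals give the basis property on facets; the factorization through [P] serves to compute the
    kernel of [P]. *)
Lemma facet_dual_family a t (P : 'M[R]_(dimJ n J, n)) :
  (forall b, row_span Lam (spread b (p b))) ->
  (forall x, spread a (p a) x = Lam x *m P) ->
  t \in K -> #|t| = n ->
  exists2 Y, dual_family (facet_of a t) Lam Y &
    forall u, u \notin sigma_of a -> exists z, Y u = P *m z.
Proof.
move=> LS PE tK tn.
have [T dT] := basis_dual_family tn (p_char a tK tn).
(* For u = i_j in sigma(a), changing the i-th coordinate of a to j gives b with
   u the only vertex of sigma(a) that b picks, and p b i is unimodular. Values at
   the picked vertices are corrected afterwards by the functionals from P. *)
have /fin_all_exists[Y0 Y0P] (u : {i : 'I_m & 'I_(J i)}) :
    exists y : 'cV[R]_(dimJ n J),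
    forall x : {i : 'I_m & 'I_(J i)},
      tagged x != a (tag x) -> Lam x *m y = (x == u)%:R%:M.
  case: u => i j; pose b : Ivert J := dfwith a j.
  have [z zE] := char_map_unimodular b i; have [Q QE] := LS b.
  exists (Q *m z) => -[i' j'] /= ja; rewrite mulmxA -QE /spread /=.
  have [E|ni] := eqVneq i' i; last first.
    have -> : b i' = a i' by rewrite /b dfwith_out // eq_sym.
    rewrite (negPf ja) mul0mx.
    rewrite (_ : _ == _ = false) ?raddf0 //.
    by apply/eqP => /(congr1 tag) /= /eqP; rewrite (negPf ni).
  subst i'; have -> : b i = j by apply: dfwith_in.
  rewrite -tag_eqE /tag_eq /= eqxx tagged_asE /=.
  by case: eqP => _; rewrite ?zE // mul0mx raddf0.
exists (fun u => if u \in sigma_of a then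
   Y0 u - \sum_(l in t) (Lam (pick_of a l) *m Y0 u) 0 0 *: (P *m T l)
   else P *m T (tag u)); last by move=> u /negPf->; exists (T (tag u)).
have LT x l : Lam x *m (P *m T l) =
    if tagged x == a (tag x) then p a (tag x) *m T l else 0.
  by rewrite mulmxA -PE /spread; case: ifP => // _; rewrite mul0mx.
move=> x u; rewrite !inE => xS uS.
case: (boolP (tagged u != a (tag u))) uS => /= [ua _|/negPn/eqP ua ut]; last first.
  rewrite LT; case: eqVneq xS => /= [xa xt|xa _].
    rewrite dT //; congr (_%:R%:M).
    case: x u xa ua xt ut => [i j] [i' j'] /= -> -> _ _.
    rewrite -tag_eqE /tag_eq /=; case: eqVneq => //= E; subst i'.
    by rewrite tagged_asE eqxx.
  rewrite (_ : _ == _ = false) ?raddf0 //.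
  by apply/eqP => E; rewrite E ua eqxx in xa.
rewrite mulmxBr mulmx_sumr.
case: eqVneq xS => /= [xa xt|xa _]; last first.
  rewrite Y0P // big1 ?subr0 // => l lt.
  by rewrite -scalemxAr LT (negPf xa) scaler0.
rewrite (bigD1 (tag x)) //= big1 ?addr0 => [|l /andP[lt lx]]; last first.
  by rewrite -scalemxAr LT xa eqxx dT // eq_sym (negPf lx) raddf0 scaler0.
rewrite -scalemxAr LT xa eqxx dT // eqxx scale_scalar_mx mulr1 -mx11_scalar.
rewrite (_ : x == u = false) ?raddf0; last first.
  by apply/eqP => E; rewrite -E xa eqxx in ua.
rewrite (_ : pick_of a (tag x) = x) ?subrr // /pick_of -xa.
by case: (x).
Qed.

End RowSpanChar.

Lemma realizableP K J (p : Ivert J -> 'I_m -> 'rV[R]_n) :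
    has_dim_pred K n ->
    (forall i, exists s : {set 'I_m}, [/\ s \in K, i \in s & #|s| = n]) ->
    (forall i, (0 < J i)%N) ->
    (forall a, char_map K (p a)) ->
  realizable K p <->
  exists Lam : {i : 'I_m & 'I_(J i)} -> 'rV[R]_(dimJ n J),
    forall a, row_span Lam (spread a (p a)).
Proof.
move=> [Kn [t0 t0K t0n]] pure J0 pch; split=> [[Lam [_ pL]]|[Lam LS]].
  by exists Lam => a; apply: proj_alpha_row_span.
exists Lam; split=> [S SK cS|a].
  have [a [t [tK tn ->]]] := KJ_facetP J0 Kn SK cS.
  have [P PE] := LS a.
  have [Y dY _] := facet_dual_family pure pch LS PE tK tn.
  by apply: dual_family_basis dY; rewrite card_facet_of tn.
have [P PE] := LS a; exists P; split=> [x|y|i]; last by rewrite -PE spread_pick.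
- have [Y dY Yz] := facet_dual_family pure pch LS PE t0K t0n.
  split=> [xP|[c ->]]; last first.
    rewrite mulmx_suml big1 // => u; rewrite inE => ua.
    by rewrite -scalemxAl -PE /spread (negPf ua) scaler0.
  (* Coordinates of [x] outside sigma(a) vanish, since their functionals factor through [P]. *)
  exists (fun u => (x *m Y u) 0 0).
  rewrite {1}(dual_family_expand _ dY x) ?card_facet_of ?t0n //.
  rewrite (big_setID (sigma_of a)) /= [X in _ + X]big1 ?addr0.
    apply: eq_bigl => u; rewrite !inE.
    by case: (tagged u == _); rewrite ?andbF.
  move=> u; rewrite inE => /andP[/Yz[z ->] _].
  by rewrite mulmxA xP mul0mx mxE scale0r.
have [sp _] := pch a _ t0K t0n.
have [c ->] := sp y; exists (\sum_(i in t0) c i *: Lam (pick_of a i)).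
rewrite mulmx_suml; apply: eq_bigr => i _.
by rewrite -scalemxAl -PE spread_pick.
Qed.

(** * The star condition at a base vertex *)

Definition move1 J (a0 a : Ivert J) (v : 'I_m) : Ivert J :=
  fun i => if i == v then a i else a0 i.

Definition moved J (a0 a : Ivert J) : {set 'I_m} := [set v | a v != a0 v].

(* [lam], extended by zero, is a combination (with coefficients [A] and [B]) of
   [lam0] placed on a0 and the [mu v] placed on a0 moved along v, for [v] in [D]:
   the first equation is read off at the vertices i_(a0 i), the second one at the
   vertices i_(a i) with i in [D]. *)
Definition spanned_by_star (lam0 lam : 'I_m -> 'rV[R]_n)
    (mu : 'I_m -> 'I_m -> 'rV[R]_n) (D : {set 'I_m}) : Prop :=
  exists (A : 'M_n) (B : 'I_m -> 'M_n), forall i,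
    lam0 i *m A + \sum_(v in D :\ i) mu v i *m B v = (if i \in D then 0 else lam i)
    /\ (i \in D -> lam i = mu i i *m B i).

(** Over i, the summand [v = i] lives at i_(a i), all others at i_(a0 i). *)
Lemma sum_spread_move1 J (a0 a : Ivert J) k (mu : 'I_m -> 'I_m -> 'rV[R]_n)
    (B : 'I_m -> 'M_(n, k)) x :
  \sum_(v in moved a0 a) spread (move1 a0 a v) (mu v) x *m B v =
  (if (tag x \in moved a0 a) && (tagged x == a (tag x))
   then mu (tag x) (tag x) *m B (tag x) else 0) +
  (if tagged x == a0 (tag x)
   then \sum_(v in moved a0 a :\ tag x) mu v (tag x) *m B v else 0).
Proof.
case: x => i j /=.
have rest : \sum_(v in moved a0 a :\ i)
      spread (move1 a0 a v) (mu v) (Tagged (fun i => 'I_(J i)) j) *m B v =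
    if j == a0 i then \sum_(v in moved a0 a :\ i) mu v i *m B v else 0.
  case: ifP => ja; [apply: eq_bigr | apply: big1] => v; rewrite !inE => /andP[vi _];
  by rewrite /spread /move1 /= [i == v]eq_sym (negPf vi) ja // mul0mx.
case: ifPn => [/andP[iD /eqP ja]|].
  by rewrite (big_setD1 i iD) /= rest {1}/spread /move1 /= eqxx ja eqxx.
rewrite add0r -rest; have [iD|iD] := boolP (i \in moved a0 a) => /= ja.
  by rewrite (big_setD1 i iD) /= {1}/spread /move1 /= eqxx (negPf ja) mul0mx add0r.
by apply: eq_bigl => v; rewrite in_setD1; case: eqVneq => // ->; rewrite (negPf iD).
Qed.

Section StarCondition.
Variables (K : {set {set 'I_m}}) (J : 'I_m -> nat).
Variable p : Ivert J -> 'I_m -> 'rV[R]_n.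
Hypothesis K_dim : has_dim_pred K n.
Hypothesis K_pure :
  forall i, exists s : {set 'I_m}, [/\ s \in K, i \in s & #|s| = n].
Hypothesis J_gt0 : forall i, (0 < J i)%N.
Hypothesis p_char : forall a, char_map K (p a).

Lemma realizable_spanned_by_star a0 a : realizable K p ->
  spanned_by_star (p a0) (p a) (fun v => p (move1 a0 a v)) (moved a0 a).
Proof.
move=> [Lam [_ pL]].
have LS b := proj_alpha_row_span (pL b).
have [P PE] := LS a.
have /fin_all_exists[Q QE] v := LS (move1 a0 a v).
have /fin_all_exists[z zE] v := char_map_unimodular K_pure p_char (move1 a0 a v) v.
(* The v-th summand then equals [p a v] at v_(a v), so [Y] below vanishes on sigma(a0) and factors
   through the projection there. *)
pose B v := z v *m p a v.
pose Y := P - \sum_(v in moved a0 a) Q v *m B v.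
have LY x : Lam x *m Y = spread a (p a) x -
    \sum_(v in moved a0 a) spread (move1 a0 a v) (p (move1 a0 a v)) x *m B v.
  rewrite mulmxBr mulmx_sumr -PE; congr (_ - _); apply: eq_bigr => v _.
  by rewrite QE mulmxA.
have [|A AE] := proj_alpha_factor (pL a0) (Y := Y).
  move=> [i j]; rewrite inE /= => ja; rewrite LY sum_spread_move1 /=.
  rewrite (negPf ja) addr0.
  rewrite /spread /= /B mulmxA zE mul1mx inE.
  by case: eqVneq => [<-|_]; rewrite ?ja ?andbF ?subrr.
exists A, B => i; split=> [|_]; last by rewrite /B mulmxA zE mul1mx.
rewrite -AE LY sum_spread_move1 /= eqxx /spread /= !inE.
rewrite [a i == _]eq_sym; case: eqVneq => /= [|ai]; first by rewrite add0r subrK.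
by rewrite !add0r addNr.
Qed.

(** [Lam] lists the coordinates of [p a0] and, for each u in sigma(a0), one function with value 1 at
    u from the neighbour of [a0] picking u; link compatibility recovers the rest of that
    neighbour. *)
Lemma spanned_by_star_realizable a0 : link_compatible p ->
  (forall a, spanned_by_star (p a0) (p a) (fun v => p (move1 a0 a v)) (moved a0 a)) ->
  realizable K p.
Proof.
move=> link star; apply/realizableP => //.
(* This is sigma(a0), in a form whose size [card_facet_of] computes. *)
pose S := facet_of a0 set0.
have -> : dimJ n J = (n + #|S|)%N by rewrite card_facet_of cards0 add0n.
pose b (u : {i : 'I_m & 'I_(J i)}) : Ivert J := dfwith a0 (tagged u).
have /fin_all_exists[z zE] u := char_map_unimodular K_pure p_char (b u) (tag u).
pose w u x := (spread (b u) (p (b u)) x *m z u) 0 0.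
pose Lam (x : {i : 'I_m & 'I_(J i)}) :=
  row_mx (spread a0 (p a0) x) (\row_(j < #|S|) w (enum_val j) x).
exists Lam.
have span0 : row_span Lam (spread a0 (p a0)).
  by exists (col_mx 1%:M 0) => x; rewrite mul_row_col mulmx1 mulmx0 addr0.
have spanw u : u \in S -> row_span Lam (fun x => spread (b u) (p (b u)) x *m z u).
  move=> uS; exists (col_mx 0 (delta_mx (enum_rank_in uS u) 0)) => x.
  rewrite mul_row_col mulmx0 add0r -colE; apply/matrixP => i j.
  by rewrite !ord1 !mxE enum_rankK_in // /w mxE.
have spanb u : u \in S -> row_span Lam (spread (b u) (p (b u))).
  (* [Y] subtracts the multiple of [z u] that cancels the value at u. *)
  move=> uS; pose Y := 1%:M - z u *m p (b u) (tag u).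
  have Y0 : p (b u) (tag u) *m Y = 0.
    by rewrite mulmxBr mulmx1 mulmxA zE mul1mx subrr.
  have bu i : i != tag u -> a0 i = b u i.
    by move=> iu; rewrite /b dfwith_out // eq_sym.
  have [A AE] := link _ _ _ bu Y Y0.
  apply: row_span_ext (row_spanD (row_span_mul (p (b u) (tag u)) (spanw u uS))
                                (row_span_mul A span0)) => x.
  suff -> : spread a0 (p a0) x *m A = spread (b u) (p (b u)) x *m Y.
    by rewrite mulmxBr mulmx1 mulmxA addrC subrK.
  rewrite -!spread_mul /spread -AE.
  have [xu|/bu->//] := eqVneq (tag x) (tag u).
  suff -> : p (b u) (tag x) *m Y = 0 by rewrite !if_same.
  by rewrite xu Y0.
move=> a; have [A [B AB]] := star a.
apply: (row_span_ext (G1 := fun x => spread a0 (p a0) x *m A +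
  \sum_(v in moved a0 a) spread (move1 a0 a v) (p (move1 a0 a v)) x *m B v)).
  move=> x; rewrite sum_spread_move1; have [] := AB (tag x).
  rewrite /spread inE; case: eqVneq => [-> E _|ai E1 E2] /=.
    rewrite add0r; case: eqVneq => // _; by rewrite mul0mx addr0.
  case: (eqVneq (tagged x) (a0 _)) => [->|_].
    by rewrite eq_sym (negPf ai) add0r E1.
  by rewrite mul0mx add0r addr0 -E2.
apply: row_spanD; first exact: row_span_mul.
apply: row_span_sum => v; rewrite inE => va; apply: row_span_mul.
suff -> : move1 a0 a v = b (Tagged (fun i => 'I_(J i)) (a v)).
  by apply: spanb; rewrite inE /= va.
apply: functional_extensionality_dep => i; rewrite /move1 /b.
by case: dfwithP => [|j vj]; rewrite ?eqxx // eq_sym (negPf vj).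
Qed.

End StarCondition.

End Puzzles.

(** * Passage to subcubes *)

Lemma strictly_increasing_inj k l (f : 'I_k -> 'I_l) :
  strictly_increasing f -> injective f.
Proof.
move=> fI x y fxy; apply: val_inj.
by case: (ltngtP (val x) (val y)) => // /fI; rewrite fxy ltnn.
Qed.

(** Both directions transport the star condition along [e], which commutes with [move1] and
    preserves [moved]. *)
Lemma realizable_subcubes (R : comUnitRingType) (m n : nat) (K : {set {set 'I_m}})
  (J : 'I_m -> nat) (p : Ivert J -> 'I_m -> 'rV[R]_n) :
  has_dim_pred K n ->
  (forall i, exists s : {set 'I_m}, [/\ s \in K, i \in s & #|s| = n]) ->
  (forall i, 0 < J i)%N ->
  is_puzzle K p ->
  realizable K p <->
  (forall (J' : 'I_m -> nat), (forall i, 0 < J' i <= 2)%N ->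
   forall e : (forall i, 'I_(J' i) -> 'I_(J i)),
     (forall i, strictly_increasing (e i)) ->
     realizable K (subpuzzle e p)).
Proof.
move=> Kd Kp J0 puz; have [pch _] := puz; have link := is_puzzle_link puz.
split=> [real J' J'2 e eI|cubes].
  have J'0 i : (0 < J' i)%N by case/andP: (J'2 i).
  pose ee (a : Ivert J') : Ivert J := fun i => e i (a i).
  pose b0 : Ivert J' := fun i => Ordinal (J'0 i).
  apply: (@spanned_by_star_realizable _ _ _ _ _ _ Kd Kp J'0 _ b0) => [a|a b v ab|a].
  - exact: pch.
  - by apply: link (v) _ => i iv; rewrite ab.
  have := realizable_spanned_by_star Kp pch (ee b0) (ee a) real.
  have -> : moved (ee b0) (ee a) = moved b0 a.
    by apply/setP => v; rewrite !inE (inj_eq (strictly_increasing_inj (eI v))).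
  have -> : (fun v => p (move1 (ee b0) (ee a) v)) =
      (fun v => subpuzzle e p (move1 b0 a v)).
    apply: functional_extensionality => v; congr p.
    apply: functional_extensionality_dep => i.
    by rewrite /move1 /ee; case: eqP.
  by [].
(* The least vertex as base makes [e] below, sending 0 to [a0 i] and 1 to [a i], strictly
   increasing. *)
pose a0 : Ivert J := fun i => Ordinal (J0 i).
apply: (@spanned_by_star_realizable _ _ _ _ _ _ Kd Kp J0 pch a0 link) => a.
pose J' i := (a0 i != a i).+1.
pose e i (k : 'I_(J' i)) := if val k == 0%N then a0 i else a i.
have J'2 i : (0 < J' i <= 2)%N by rewrite /J'; case: (_ != _).
have eI i : strictly_increasing (e i).
  move=> x y xy; have y0 : (0 < y)%N by apply: leq_ltn_trans xy.
  have := ltn_ord y; rewrite {2}/J'; case: eqVneq => [_|ai y2].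
    by rewrite ltnS leqNgt y0.
  have -> : e i x = a0 i by rewrite /e -leqn0 -ltnS (leq_trans xy y2).
  rewrite /e -[val y == _]negbK -lt0n y0 /= lt0n; apply: contra ai => /eqP ai.
  by apply/eqP/val_inj.
pose b0 : Ivert J' := fun i => ord0.
(* [ord_max] is 1 on moved coordinates and 0 elsewhere, where [a0 i = a i]. *)
pose b1 : Ivert J' := fun i => ord_max.
have eb0 : (fun i => e i (b0 i)) = a0 by [].
have eb1 : (fun i => e i (b1 i)) = a.
  apply: functional_extensionality_dep => i; rewrite /e /=.
  by case: (eqVneq (a0 i) (a i)) => [->|].
have := realizable_spanned_by_star Kp (p := subpuzzle e p)
  (fun c => pch _) b0 b1 (cubes J' J'2 e eI).
rewrite {1 2}/subpuzzle eb0 eb1.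
have -> : moved b0 b1 = moved a0 a.
  by apply/setP => v; rewrite !inE -val_eqE /= eqb0 negbK eq_sym.
have -> : (fun v => subpuzzle e p (move1 b0 b1 v)) = (fun v => p (move1 a0 a v)).
  apply: functional_extensionality => v; congr p.
  apply: functional_extensionality_dep => i.
  rewrite /move1; case: ifP => _; last by [].
  by rewrite -[in RHS]eb1.
by [].
Qed.

(* b = true : R = Z ;  b = false : R = Z_2 *)
Theorem mainTheorem8 (b : bool) (m n : nat) (K : {set {set 'I_m}})
  (J : 'I_m -> nat) (p : Ivert J -> 'I_m -> 'rV[coef_ring b]_n) :
  star_shaped_sphere n K ->
  (forall i, 0 < J i)%N ->
  is_puzzle K p ->
  realizable K p <->
  (forall (J' : 'I_m -> nat), (forall i, 0 < J' i <= 2)%N ->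
   forall e : (forall i, 'I_(J' i) -> 'I_(J i)),
     (forall i, strictly_increasing (e i)) ->
     realizable K (subpuzzle e p)).
Proof.
move=> sK; apply: realizable_subcubes; last exact: star_shaped_sphere_pure sK.
by case: sK.
Qed.
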